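(* Let $\beta\geq\frac{1+\sqrt5}{2}$ and let $\mathrm{d}_{-\beta}(l_\beta)=d_1d_2d_3\cdots$ satisfy $0<d_i$ and $d_1>d_{2i}$ for all $i=1,2,3,\dots$. Define \[ \Delta_0=1,\qquad \Delta_k=\Big|(-1)^k+\sum_{i=1}^\infty\frac{d_{k-1+i}-d_{k+i}}{(-\beta)^i}\Big|,\quad k=1,2,3,\dots \] Then the distance between any two consecutive elements of $\mathbb{Z}_{-\beta}$ belongs to $\{\Delta_k: k\ge0\}$, and all such distances are less than $2$.
   Context: Let $\beta>1$, $\mathcal{A}_\beta=\{0,1,\dots,\lfloor\beta\rfloor\}$, $l_\beta=\frac{-\beta}{\beta+1}$, $r_\beta=\frac1{\beta+1}$, $I_\beta=[l_\beta,r_\beta)$, $T_{-\beta}(x)=-\beta x-\lfloor -\beta x+\frac{\beta}{\beta+1}\rfloor$ on $I_\beta$. The $(-\beta)$-expansion of $x\in I_\beta$ is $\mathrm{d}_{-\beta}(x)=x_1x_2\cdots$ with $x_i=\lfloor -\beta T_{-\beta}^{i-1}(x)+\frac{\beta}{\beta+1}\rfloor$. An infinite string over $\mathcal{A}_\beta$ is $(-\beta)$-admissible if it is $\mathrm{d}_{-\beta}(x)$ for some $x\in I_\beta$. For a finite string $a_k\cdots a_0$ over $\mathcal{A}_\beta$, $\gamma(a_k\cdots a_0)=\sum_{i=0}^ka_i(-\beta)^i$. The set of $(-\beta)$-integers is $\mathbb{Z}_{-\beta}=\{\gamma(a_k\cdots a_0): a_k\cdots a_00^\omega\text{ is admissible}\}$,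 where $0^\omega$ is the infinite repetition of $0$. *)

(* Defs.v *)
From mathcomp Require Import all_boot all_order all_algebra.
From mathcomp Require Import boolp classical_sets reals topology normedtype.
From mathcomp Require Import sequences.

Set Implicit Arguments.
Unset Strict Implicit.
Unset Printing Implicit Defensive.

Import Order.TTheory GRing.Theory Num.Theory.
Import numFieldNormedType.Exports.

Local Open Scope classical_set_scope.
Local Open Scope ring_scope.

Definition alphabet (R : realType) (beta : R) : set int :=
  [set a | 0 <= a <= Num.floor beta].

Definition l_ (R : realType) (beta : R) : R := - beta / (beta + 1).

Definition r_ (R : realType) (beta : R) : R := 1 / (beta + 1).

Definition I_ (R : realType) (beta : R) : set R :=
  [set x | l_ beta <= x < r_ beta].

Definition T_ (R : realType) (beta : R) (x : R) : R :=
  - beta * x - (Num.floor (- beta * x + beta / (beta + 1)))%:~R.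

(* Infinite strings w_1 w_2 w_3 ... are functions [w : nat -> int] read at the
   positions i >= 1 only; the value at 0 is irrelevant. *)
Definition expansion (R : realType) (beta : R) (x : R) (i : nat) : int :=
  Num.floor (- beta * iter i.-1 (T_ beta) x + beta / (beta + 1)).

Definition admissible (R : realType) (beta : R) (w : nat -> int) : Prop :=
  (forall i, (1 <= i)%N -> alphabet beta (w i)) /\
  exists2 x : R, I_ beta x & forall i, (1 <= i)%N -> w i = expansion beta x i.

(* Finite strings a_k ... a_0 are written [:: a_k; ...; a_0]. *)
Definition gamma (R : realType) (beta : R) (s : seq int) : R :=
  \sum_(0 <= i < size s) (nth 0 (rev s) i)%:~R * (- beta) ^+ i.

(* s 0^omega *)
Definition pad0 (s : seq int) (i : nat) : int := nth 0 s i.-1.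

Definition beta_integers (R : realType) (beta : R) : set R :=
  [set gamma beta s | s in [set s | s <> [::] /\ admissible beta (pad0 s)]].

Definition consecutive (R : realType) (A : set R) (x y : R) : Prop :=
  [/\ A x, A y, x < y & forall z, A z -> ~~ (x < z < y)].

Definition Delta (R : realType) (beta : R) (d : nat -> int) (k : nat) : R :=
  if k == 0 then 1 else
  `| (-1) ^+ k + \big[+%R/0]_(1 <= i <oo)
       ((d (k - 1 + i)%N - d (k + i)%N)%:~R / (- beta) ^+ i) |.

(* Main.v *)
(* Write T for the (-beta)-transformation on I = [l, l + 1) and V_n for the zeros
   of T^n in I. Since T^n(l) < 0 for all n, the sets (-beta)^n V_n increase, and
   their union is Z_{-beta}.
   Pulling back along T, two consecutive points of V_{n+1} either lie in the
   same branch, and then map to consecutive points of V_n, or lie in adjacent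
   branches, and then map to min V_n and max V_n. Hence the only new rescaled
   gap at step n+1 is the cyclic gap beta^n (1 + min V_n - max V_n).
   Following the point of V_n nearest to T^k(l), on the right for k even and on
   the left for k odd, along the orbit of l gives
   beta^n (min V_n - l) = D_n := -T^n(l) (n even) or 1 + T^n(l) (n odd), the
   conditions on the d_i being what makes the branches along the way available.
   As max V_{n+1} = - min V_n / beta, the cyclic gap is D_n + D_{n-1} = Delta_n. *)
Require Import Defs.
From mathcomp Require Import all_boot all_order all_algebra.
From mathcomp Require Import boolp classical_sets reals topology normedtype.
From mathcomp Require Import sequences.
From mathcomp Require Import ring lra.

Set Implicit Arguments.
Unset Strict Implicit.
Unset Printing Implicit Defensive.

Import Order.TTheory GRing.Theory Num.Theory.
Import numFieldNormedType.Exports.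

Local Open Scope classical_set_scope.
Local Open Scope ring_scope.

Definition digit (R : realType) (beta x : R) : int :=
  Num.floor (- beta * x + beta / (beta + 1)).

Definition zeros (R : realType) (beta : R) (n : nat) : set R :=
  [set x | I_ beta x /\ iter n (T_ beta) x = 0].

Definition endpoint_gap (R : realType) (beta : R) (k : nat) : R :=
  if odd k then 1 + iter k (T_ beta) (l_ beta)
  else - iter k (T_ beta) (l_ beta).

(** * Branches, digits and zeros of the iterates of the transformation *)

Section Transformation.
Variables (R : realType) (beta : R).
Hypothesis beta_gt1 : 1 < beta.

Local Notation T := (T_ beta).
Local Notation l := (l_ beta).
Local Notation digit := (digit beta).
Local Notation zeros := (zeros beta).

(** Multiplication by [-beta] sends the excluded endpoint [l + 1] to [l]. Hence digits are
    nonnegative, and the branch of digit 0 is the rightmost one. *)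
Lemma beta_l : beta * (l + 1) = - l.
Proof. have b1 := beta_gt1. by rewrite /l_; field; apply: lt0r_neq0; lra. Qed.

Lemma r_l : r_ beta = l + 1.
Proof. have b1 := beta_gt1. by rewrite /r_ /l_; field; apply: lt0r_neq0; lra. Qed.

Lemma l_lt0 : l < 0.
Proof. have b1 := beta_gt1. by rewrite /l_ mulNr oppr_lt0 divr_gt0 //; lra. Qed.

Lemma l_gtN1 : -1 < l.
Proof. have b1 := beta_gt1. by have := l_lt0; have := beta_l; nra. Qed.

Lemma I_E x : I_ beta x <-> l <= x < l + 1.
Proof. by rewrite /I_ /= r_l. Qed.

Lemma digitE x : digit x = Num.floor (- beta * x - l).
Proof. by rewrite /digit /l_ [- beta / _]mulNr opprK. Qed.

Lemma T_E x : T x = - beta * x - (digit x)%:~R.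
Proof. by []. Qed.

Lemma digit_itv x :
  (digit x)%:~R <= - beta * x - l < (digit x)%:~R + 1.
Proof. by have := floor_itv (- beta * x - l); rewrite -digitE intrD. Qed.

Lemma T_in x : I_ beta (T x).
Proof.
have b1 := beta_gt1.
by apply/I_E; rewrite T_E; have /andP[? ?] := digit_itv x; apply/andP; split; lra.
Qed.

Lemma iter_T_in n x : I_ beta x -> I_ beta (iter n T x).
Proof. by case: n => // n _; exact: T_in. Qed.

(** [I_ beta] is half-open of length 1, so a real is in only one way a point of it plus an
    integer. *)
Lemma branch y w (a : int) : I_ beta y -> - beta * w = y + a%:~R ->
  digit w = a /\ T w = y.
Proof.
have b1 := beta_gt1.
move=> /I_E/andP[ly yr] hw.
have dw : digit w = a.
  by rewrite digitE; apply: floor_def; rewrite intrD; apply/andP; split; lra.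
by rewrite T_E dw; split=> //; lra.
Qed.

Lemma digit_ge0 x : I_ beta x -> 0 <= digit x.
Proof.
have b1 := beta_gt1.
by move=> /I_E/andP[lx xr]; rewrite digitE floor_ge0; have := beta_l; nra.
Qed.

Lemma digit_anti x y : x <= y -> digit y <= digit x.
Proof. have b1 := beta_gt1. by move=> xy; rewrite !digitE; apply: le_floor; nra. Qed.

Lemma T0 : T 0 = 0.
Proof.
have b1 := beta_gt1.
suff [] : digit 0 = 0 /\ T 0 = 0 by [].
by apply: branch; [apply/I_E; have := l_lt0; have := l_gtN1; lra|rewrite mulr0 addr0].
Qed.

Lemma I0 : I_ beta 0.
Proof. have b1 := beta_gt1. by apply/I_E; have := l_lt0; have := l_gtN1; lra. Qed.

Lemma zeros0 n : zeros n 0.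
Proof. by split; [exact: I0|elim: n => //= n ->; exact: T0]. Qed.

Lemma zerosS n x : I_ beta x -> zeros n.+1 x <-> zeros n (T x).
Proof.
move=> Ix; rewrite /zeros /= -iterS iterSr.
by split=> [[_ ?]|[_ ?]]; split=> //; exact: T_in.
Qed.

Lemma zeros_branch n y w (a : int) : I_ beta w -> zeros n y ->
  - beta * w = y + a%:~R -> zeros n.+1 w.
Proof.
move=> Iw zy hw; apply/zerosS => //.
by have [_ ->] := branch (proj1 zy) hw.
Qed.

Lemma preimage_exists (y : R) : exists w, - beta * w = y.
Proof. have b1 := beta_gt1. by exists (- (y / beta)); field; apply: lt0r_neq0; lra. Qed.

End Transformation.

(** * Zeros near the orbit of [l], and the gaps of [zeros n] *)

Section Orbit.
Variables (R : realType) (beta : R).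
Hypothesis beta_gt1 : 1 < beta.

Local Notation T := (T_ beta).
Local Notation l := (l_ beta).
Local Notation digit := (digit beta).
Local Notation zeros := (zeros beta).
Local Notation t k := (iter k T l).
Local Notation D := (endpoint_gap beta).

Hypothesis digit_gt0 : forall k, 0 < digit (t k).
Hypothesis digit_lt : forall k, odd k -> digit (t k) < digit l.

Lemma orbit_ge_l k : l <= t k.
Proof.
have b1 := beta_gt1.
have : I_ beta l by apply/(I_E beta_gt1); apply/andP; split; lra.
by move/(iter_T_in beta_gt1 k)/(I_E beta_gt1)/andP =>[].
Qed.

Lemma orbit_lt0 k : t k < 0.
Proof.
have b1 := beta_gt1.
have /andP[h _] := digit_itv beta (t k).
have := digit_gt0 k; rewrite gtz0_ge1 -(ler_int R) => h1.
have := l_gtN1 beta_gt1; nra.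
Qed.

Lemma orbit_next k : - beta * t k = t k.+1 + (digit (t k))%:~R.
Proof. by rewrite iterS T_E subrK. Qed.

(** Induction on [n] for all [k] at once: a branch of [T] reverses order, so the nearest zero on one
    side of [t k] comes from the one on the other side of [t k.+1]. Odd [k] needs [0 < n] because
    [zeros 0] is {0} and the orbit is negative. *)
Lemma nearest_zero n :
  (forall k, ~~ odd k -> exists2 v, zeros n v &
     [/\ t k <= v, forall w, zeros n w -> t k <= w -> v <= w
       & beta ^+ n * (v - t k) = D (n + k)]) /\
  (forall k, odd k -> (0 < n)%N -> exists2 v, zeros n v &
     [/\ v <= t k, forall w, zeros n w -> w <= t k -> w <= v
       & beta ^+ n * (t k - v) = D (n + k)]).
Proof.
have b1 := beta_gt1.
have l0 := l_lt0 beta_gt1; have l1 := l_gtN1 beta_gt1.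
have bl := beta_l beta_gt1.
elim: n => [|n [IHe IHo]].
  split=> // k ek; exists 0; first exact: zeros0.
  split; [exact: ltW (orbit_lt0 k)|by move=> w [_ /= ->] |].
  by rewrite /endpoint_gap add0n (negbTE ek) expr0; lra.
split=> k pk.
  have := digit_gt0 k; rewrite gtz0_ge1 -(ler_int R) => d1.
  have tk := orbit_next k; have tk0 := orbit_lt0 k.+1.
  have tkl := orbit_ge_l k; have tkl' := orbit_ge_l k.+1.
  case: n IHe IHo => [|n] IHe IHo.
    (* [0], the only element of [zeros 0], is not on the left of [t k.+1], so
       the branch next to that of [t k] is used; it exists as [0 < digit (t k)]. *)
    have [v hv] := preimage_exists beta_gt1 (0 + (digit (t k) - 1)%:~R).
    have hv' := hv; rewrite intrB in hv'.
    have tv : t k <= v by nra.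
    have [dv Tv] := branch beta_gt1 (I0 beta_gt1) hv.
    exists v; [|split=> //].
    - apply: (zeros_branch beta_gt1 _ (zeros0 beta_gt1 0) hv).
      by apply/(I_E beta_gt1); apply/andP; split; nra.
    - move=> w [_ /= Tw] tw; rewrite leNgt; apply/negP => wv.
      have := digit_anti beta_gt1 tw.
      rewrite -(ler_int R) => ?.
      have hw : - beta * w = (digit w)%:~R.
        by rewrite -[LHS](subrK (digit w)%:~R) -T_E Tw add0r.
      have : (digit (t k) - 1)%:~R < (digit w)%:~R :> R by rewrite intrB; nra.
      rewrite ltr_int ltrBlDr ltzD1 -(ler_int R) => ?; nra.
    - have -> : D (1 + k) = 1 + t k.+1 by rewrite /endpoint_gap add1n [odd _]/= pk.
      by rewrite expr1; lra.
  have [v' zv' [v't min_v' gap]] := IHo k.+1 pk isT.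
  have [Iv' _] := zv'; move/(I_E beta_gt1)/andP: Iv' => [v'l v'r].
  have [v hv] := preimage_exists beta_gt1 (v' + (digit (t k))%:~R).
  have [dv Tv] := branch beta_gt1 (proj1 zv') hv.
  have tv : t k <= v by nra.
  exists v; [|split=> //].
  - apply: (zeros_branch beta_gt1 _ zv' hv).
    by apply/(I_E beta_gt1); apply/andP; split; nra.
  - move=> w zw tw; rewrite leNgt; apply/negP => wv.
    (* As [digit] is antitone, a closer zero [w] lies in the common branch of [t k] and [v]; then
       [T w] would be nearer to [t k.+1] than [v']. *)
    have dw : digit w = digit (t k).
      apply/le_anti/andP; split; first exact: digit_anti.
      by rewrite -{1}dv; apply: digit_anti => //; exact: ltW.
    have hw : - beta * w = T w + (digit w)%:~R by rewrite T_E subrK.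
    have := min_v' (T w); rewrite -zerosS //; last exact: (proj1 zw).
    by rewrite dw in hw; move=> /(_ zw); nra.
  - rewrite addSnnS -gap exprSr -mulrA; congr (_ * _); lra.
move=> _.
(* This keeps [v] inside the interval: [-beta * v = v' + digit (t k) < l + digit l <= -beta * l], so
   [l < v]. *)
have dlt : (digit (t k))%:~R + 1 <= (digit l)%:~R :> R.
  by have := digit_lt pk; rewrite -lezD1 -(ler_int R) intrD.
have tk := orbit_next k; have tl := orbit_next 0.
have t1l := orbit_ge_l 1; rewrite /= in tl t1l.
have tk0 := orbit_lt0 k; have tkl := orbit_ge_l k.
have ek : ~~ odd k.+1 by rewrite /= pk.
have [v' zv' [v't min_v' gap]] := IHe k.+1 ek.
have [Iv' _] := zv'; move/(I_E beta_gt1)/andP: Iv' => [v'l v'r].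
have [v hv] := preimage_exists beta_gt1 (v' + (digit (t k))%:~R).
have [dv Tv] := branch beta_gt1 (proj1 zv') hv.
have tv : v <= t k by nra.
exists v; [|split=> //].
- apply: (zeros_branch beta_gt1 _ zv' hv).
  by apply/(I_E beta_gt1); apply/andP; split; nra.
- move=> w zw tw; rewrite leNgt; apply/negP => wv.
  have dw : digit w = digit (t k).
    apply/le_anti/andP; split; last exact: digit_anti.
    by rewrite -{1}dv; apply: digit_anti => //; exact: ltW.
  have hw : - beta * w = T w + (digit w)%:~R by rewrite T_E subrK.
  have := min_v' (T w); rewrite -zerosS //; last exact: (proj1 zw).
  by rewrite dw in hw; move=> /(_ zw); nra.
- rewrite addSnnS -gap exprSr -mulrA; congr (_ * _); lra.
Qed.

Lemma zeros_neq_l n : ~ zeros n l.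
Proof. by case=> _ /= h; have := orbit_lt0 n; rewrite /= h ltxx. Qed.

Lemma zeros_min n : exists2 m, zeros n m &
  (forall w, zeros n w -> m <= w) /\ beta ^+ n * (m - l) = D n.
Proof.
have [/(_ 0%N isT)[m zm [_ min_m gap]] _] := nearest_zero n.
exists m => //; split; last by rewrite addn0 in gap.
move=> w zw; apply: min_m => //.
by have [/(I_E beta_gt1)/andP[]] := zw.
Qed.

(** [T] decreases on the rightmost branch, that of digit 0, so the largest zero at level [n.+1] is
    the preimage there of the smallest one at level [n]. *)
Lemma zeros_max n : exists2 M, zeros n M &
  (forall w, zeros n w -> w <= M) /\
  beta ^+ n * (l + 1 - M) = if n is n'.+1 then D n' else l + 1.
Proof.
have b1 := beta_gt1.
have bl := beta_l beta_gt1.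
case: n => [|n].
  exists 0; first exact: zeros0.
  by split=> [w [_ /= ->] //|]; rewrite expr0 mul1r subr0.
have [m zm [min_m gap]] := zeros_min n.
have [Im _] := zm; move/(I_E beta_gt1)/andP: Im => [ml mr].
(* If [m] were [l], the preimage [M] would be [l + 1], outside [I_ beta]. *)
have lm : l < m.
  rewrite lt_neqAle ml andbT; apply/eqP => h; rewrite -h in zm.
  exact: zeros_neq_l zm.
have [M hM] := preimage_exists beta_gt1 (m + 0%:~R).
have hM' : - beta * M = m by rewrite hM addr0.
exists M.
  apply: (zeros_branch beta_gt1 _ zm hM).
  apply/(I_E beta_gt1); have := l_lt0 beta_gt1; have := l_gtN1 beta_gt1.
  by move=> ? ?; apply/andP; split; nra.
split=> [w zw|].
  have := min_m (T w); rewrite -zerosS //; last exact: (proj1 zw).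
  move=> /(_ zw) h.
  have := digit_ge0 beta_gt1 (proj1 zw); rewrite -(ler_int R) => ?.
  have hw : - beta * w = T w + (digit w)%:~R by rewrite T_E subrK.
  by nra.
by rewrite -gap exprSr -mulrA; congr (_ * _); lra.
Qed.

Lemma zeros_gap n u v : consecutive (zeros n) u v ->
  exists k, beta ^+ n * (v - u) = if k is k'.+1 then D k' + D k else 1.
Proof.
have b1 := beta_gt1.
have l0 := l_lt0 beta_gt1; have l1 := l_gtN1 beta_gt1.
elim: n u v => [|n IH] u v [zu zv uv nb].
  by case: zu zv uv => [_ /= ->] [_ /= ->]; rewrite ltxx.
have [Iu _] := zu; move/(I_E beta_gt1)/andP: (Iu) => [ul ur].
have [Iv _] := zv; move/(I_E beta_gt1)/andP: (Iv) => [vl vr].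
have hu : - beta * u = T u + (digit u)%:~R by rewrite T_E subrK.
have hv : - beta * v = T v + (digit v)%:~R by rewrite T_E subrK.
have zTu : zeros n (T u) by apply/zerosS.
have zTv : zeros n (T v) by apply/zerosS.
have [/(I_E beta_gt1)/andP[Tul Tur] _] := zTu.
have [/(I_E beta_gt1)/andP[Tvl Tvr] _] := zTv.
(* No integer translate of a point of [zeros n] lies strictly between [-beta * v] and [-beta * u]:
   its preimage would be a zero between [u] and [v]. *)
have nb' z (a : int) : zeros n z ->
    ~ (T v + (digit v)%:~R < z + a%:~R < T u + (digit u)%:~R).
  move=> zz /andP[h1 h2].
  have [w hw] := preimage_exists beta_gt1 (z + a%:~R).
  have uw : u < w by nra.
  have wv : w < v by nra.
  have Iw : I_ beta w by apply/(I_E beta_gt1); apply/andP; split; lra.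
  by have := nb w (zeros_branch beta_gt1 Iw zz hw); rewrite uw wv.
have := digit_anti beta_gt1 (ltW uv); rewrite le_eqVlt => /orP[/eqP e|dlt].
  have [k hk] : exists k, beta ^+ n * (T u - T v) =
      if k is k'.+1 then D k' + D k else 1.
    apply: IH; split=> //; first by rewrite -e in hu; nra.
    move=> z zz; apply/negP => /andP[h1 h2].
    by apply: (nb' z (digit v) zz); rewrite -e !ltrD2r h1 h2.
  exists k; rewrite -hk exprSr -mulrA; congr (_ * _); rewrite -e in hu; lra.
(* If the digits differed by 2 or more, the translate of 0 by [digit u - 1] would lie in between. *)
have e : digit u = digit v + 1.
  apply/eqP; rewrite eq_le lezD1 dlt andbT leNgt -ltrBrDr; apply/negP => lt1.
  have := lt1; rewrite -lezD1 -(ler_int R) intrD => ?.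
  apply: (nb' 0 (digit u - 1) (zeros0 beta_gt1 n)).
  by rewrite intrB in lt1 *; apply/andP; split; lra.
have eR : (digit u)%:~R = (digit v)%:~R + 1 :> R by rewrite e intrD.
have [m zm [min_m gap_m]] := zeros_min n.
have [M zM [max_M gap_M]] := zeros_max n.
have [/(I_E beta_gt1)/andP[ml mr] _] := zm.
have [/(I_E beta_gt1)/andP[Ml Mr] _] := zM.
have Tu : T u = m.
  apply/eqP; rewrite eq_le min_m // andbT leNgt; apply/negP => lt.
  by apply: (nb' m (digit u) zm); apply/andP; split; lra.
have Tv : T v = M.
  apply/eqP; rewrite eq_le max_M //= leNgt; apply/negP => lt.
  by apply: (nb' M (digit v) zM); apply/andP; split; lra.
have -> : beta ^+ n.+1 * (v - u) = beta ^+ n * (m - l) + beta ^+ n * (l + 1 - M).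
  by rewrite exprSr -mulrA -mulrDr; congr (_ * _); lra.
rewrite gap_m gap_M.
case: n {IH zu zv nb zTu zTv nb' zm min_m gap_m zM max_M gap_M} => [|n].
  (* The cyclic gap of [zeros 0] is [-l + (l + 1) = 1], which is Delta_0. *)
  by exists 0; rewrite /endpoint_gap /=; lra.
by exists n.+1; rewrite addrC.
Qed.

End Orbit.

(** * From zeros to (-beta)-integers, and the series for Delta *)

Section Expansion.
Variables (R : realType) (beta : R).
Hypothesis beta_gt1 : 1 < beta.

Local Notation T := (T_ beta).
Local Notation l := (l_ beta).
Local Notation digit := (digit beta).
Local Notation zeros := (zeros beta).
Local Notation t k := (iter k T l).
Local Notation D := (endpoint_gap beta).

Lemma Nbeta_neq0 : - beta != 0.
Proof. by have b1 := beta_gt1; rewrite oppr_eq0; apply: lt0r_neq0; lra. Qed.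

Lemma bounded_div_cvg0 (c : nat -> R) : (forall k, `|c k| <= 1) ->
  (c k / (- beta) ^+ k) @[k --> \oo] --> (0 : R).
Proof.
have b1 := beta_gt1; move=> c1; apply: norm_cvg0.
have b0 : 0 < beta by lra.
apply: (@squeeze_cvgr _ _ _ _ (fun=> 0) (fun k => beta^-1 ^+ k)).
- apply: nearW => k; rewrite normr_ge0 /= normrM normfV normrX normrN.
  rewrite (gtr0_norm b0) exprVn ler_piMl // invr_ge0 exprn_ge0 //; lra.
- exact: cvg_cst.
- by apply: cvg_expr; rewrite gtr0_norm ?invr_gt0 // invf_lt1.
Qed.

Lemma I_norm_lt1 x : I_ beta x -> `|x| < 1.
Proof.
move=> /(I_E beta_gt1)/andP[lx xr]; rewrite ltr_norml.
by have := l_lt0 beta_gt1; have := l_gtN1 beta_gt1; move=> ? ?; apply/andP; split; lra.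
Qed.

(** Iterates [x = (digit x + T x) / (-beta)]. *)
Lemma expansion_sum x n : \sum_(1 <= i < n.+1)
  (expansion beta x i)%:~R / (- beta) ^+ i = x - iter n T x / (- beta) ^+ n.
Proof.
elim: n => [|n IH]; first by rewrite big_geq //= expr0 divr1 subrr.
rewrite big_nat_recr //= IH T_E -/(digit _) exprS.
have := Nbeta_neq0; have := expf_neq0 n Nbeta_neq0 => bn b.
rewrite /expansion /= -/(digit _).
by field; rewrite bn -oppr_eq0 b.
Qed.

Lemma expansionS x i : expansion beta x i.+2 = expansion beta (T x) i.+1.
Proof. by rewrite /expansion /= -iterS iterSr. Qed.

Lemma gamma_cons a s :
  gamma beta (a :: s) = a%:~R * (- beta) ^+ size s + gamma beta s.
Proof.
rewrite /gamma /= big_nat_recr //= addrC rev_cons nth_rcons size_rev ltnn eqxx.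
congr (_ + _); apply: eq_big_nat => i /andP[_ ik].
by rewrite nth_rcons size_rev ik.
Qed.

Lemma gamma_expansion s x :
  (forall i, (i < size s)%N -> nth 0 s i = expansion beta x i.+1) ->
  gamma beta s = (- beta) ^+ size s * x - iter (size s) T x.
Proof.
elim: s x => [|a s IH] x hs.
  by rewrite /gamma big_geq //= expr0 mul1r subrr.
rewrite gamma_cons (IH (T x)); last by move=> i si; rewrite -expansionS -hs.
rewrite [size _]/= -iterSr exprSr; have /= -> := hs 0%N isT.
rewrite T_E {1}/expansion /= -/(digit x); ring.
Qed.

(** With zero digits [T] merely multiplies by [-beta], and the orbit would be unbounded unless
    [y = 0]. *)
Lemma digits0_eq0 y : I_ beta y -> (forall k, digit (iter k T y) = 0) -> y = 0.
Proof.
move=> Iy hy.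
have hk k : iter k T y = (- beta) ^+ k * y.
  elim: k => [|k IH]; first by rewrite mul1r.
  by rewrite iterS T_E hy subr0 IH mulrA exprS.
have : (iter k T y / (- beta) ^+ k) @[k --> \oo] --> (0 : R).
  apply: bounded_div_cvg0 => k.
  by apply/ltW/I_norm_lt1; exact: iter_T_in.
under eq_fun do rewrite hk mulrAC divff ?mul1r ?expf_neq0 ?Nbeta_neq0 //.
by move=> /cvg_lim <- //; rewrite lim_cst.
Qed.

Lemma digit_le_floor x : I_ beta x -> digit x <= Num.floor beta.
Proof.
have b1 := beta_gt1; move=> /(I_E beta_gt1)/andP[lx xr].
by rewrite digitE; apply: le_floor; have := beta_l beta_gt1; nra.
Qed.

Lemma digit0 : digit 0 = 0.
Proof.
have := T_E beta 0; rewrite T0 // mulr0 sub0r => /esym/eqP.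
by rewrite oppr_eq0 intr_eq0 => /eqP.
Qed.

Lemma iter_T0 k : iter k T 0 = 0.
Proof. exact: (proj2 (zeros0 beta_gt1 k)). Qed.

(** A string [s] followed by zeros expands [v] exactly when [s] lists the first [n] digits of [v]
    and [T^n v] has only zero digits, that is, vanishes; then [gamma beta s] is [(-beta)^n v]. *)
Lemma beta_integersP z : beta_integers beta z <->
  exists2 n, (0 < n)%N & exists2 v, zeros n v & z = (- beta) ^+ n * v.
Proof.
split=> [[s [s0 [_ [x Ix hx]]] <-]|[n n0 [v [Iv zv] ->]]].
  have Tx0 : iter (size s) T x = 0.
    apply: digits0_eq0 => [|k]; first exact: iter_T_in.
    rewrite -iterD addnC.
    by have := hx (size s + k).+1 isT; rewrite /pad0 nth_default ?leq_addr.
  exists (size s); first by case: s s0 {hx Tx0}.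
  exists x; first by [].
  rewrite (@gamma_expansion s x) ?Tx0 ?subr0 // => i si.
  by rewrite -hx.
have pad i : (1 <= i)%N ->
    pad0 (mkseq (fun i => expansion beta v i.+1) n) i = expansion beta v i.
  case: i => // i _; rewrite /pad0 /=.
  have [ni|ni] := ltnP i n; first by rewrite nth_mkseq.
  rewrite nth_default ?size_mkseq // /expansion /= -(subnK ni) iterD zv iter_T0.
  by rewrite -/(digit 0) digit0.
exists (mkseq (fun i => expansion beta v i.+1) n).
  split; first by move/(congr1 size); rewrite size_mkseq => h; rewrite h in n0.
  split; last by exists v.
  move=> i i0; rewrite pad //.
  have Ii := iter_T_in beta_gt1 i.-1 Iv.
  by apply/andP; split; [exact: digit_ge0|exact: digit_le_floor].
rewrite (@gamma_expansion _ v) size_mkseq ?zv ?subr0 // => i si.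
by rewrite nth_mkseq.
Qed.

(** The shifted digits [d (j + i)] expand [t j], so the partial sums are differences of those for
    [t k] and [t k.+1], with a remainder of size at most [beta^-n]. *)
Lemma Delta_series (d : nat -> int) k :
  (forall i, (1 <= i)%N -> d i = expansion beta l i) ->
  \big[+%R/0]_(1 <= i <oo)
    ((d (k.+1 - 1 + i)%N - d (k.+1 + i)%N)%:~R / (- beta) ^+ i)
  = t k - t k.+1.
Proof.
move=> hd; apply: cvg_lim => //; rewrite -cvg_shiftS /=.
have e n : \sum_(1 <= i < n.+1)
    ((d (k.+1 - 1 + i)%N - d (k.+1 + i)%N)%:~R / (- beta) ^+ i)
  = t k - t k.+1 - (t (n + k) - t (n + k.+1)) / (- beta) ^+ n.
  have de j i : (1 <= i)%N -> d (j + i)%N = expansion beta (t j) i.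
    by case: i => // i _; rewrite hd ?addnS // /expansion /= addnC iterD.
  under eq_big_nat => i /andP[i1 _].
    rewrite subn1 /= !de // intrB mulrBl.
    over.
  by rewrite sumrB !expansion_sum -!iterD; ring.
under eq_fun do rewrite e.
have c1 n : `|t (n + k) - t (n + k.+1)| <= 1.
  have Il : I_ beta l by apply/(I_E beta_gt1)/andP; split; [exact: lexx|rewrite ltrDl].
  have /(I_E beta_gt1)/andP[? ?] := iter_T_in beta_gt1 (n + k) Il.
  have /(I_E beta_gt1)/andP[? ?] := iter_T_in beta_gt1 (n + k.+1) Il.
  by rewrite ler_norml; apply/andP; split; lra.
have := cvgB (cvg_cst (t k - t k.+1)) (bounded_div_cvg0 c1).
by rewrite subr0; apply.
Qed.

Hypothesis digit_gt0 : forall k, 0 < digit (t k).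
Hypothesis digit_lt : forall k, odd k -> digit (t k) < digit l.

(** The orbit lies in (-1, 0), so every [D] is positive; the expression inside the absolute value is
    [D k' + D k] up to the sign given by the parity of [k]. *)
Lemma DeltaE (d : nat -> int) k :
  (forall i, (1 <= i)%N -> d i = expansion beta l i) ->
  Delta beta d k = if k is k'.+1 then D k' + D k else 1.
Proof.
case: k => // k hd; rewrite /Delta (Delta_series k hd).
have := orbit_ge_l beta_gt1 k; have := orbit_lt0 beta_gt1 digit_gt0 k.
have := orbit_ge_l beta_gt1 k.+1; have := orbit_lt0 beta_gt1 digit_gt0 k.+1.
have := l_gtN1 beta_gt1.
rewrite /endpoint_gap -signr_odd [odd k.+1]/=; case: (odd k) => /= ? ? ? ? ?.
  by rewrite expr0 ger0_norm; lra.
by rewrite expr1 ler0_norm; lra.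
Qed.

Lemma Delta_lt2 (d : nat -> int) k :
  (forall i, (1 <= i)%N -> d i = expansion beta l i) -> Delta beta d k < 2.
Proof.
move=> hd; rewrite DeltaE //; case: k => [|k]; first lra.
have := orbit_ge_l beta_gt1 k; have := orbit_lt0 beta_gt1 digit_gt0 k.
have := orbit_ge_l beta_gt1 k.+1; have := orbit_lt0 beta_gt1 digit_gt0 k.+1.
have := l_gtN1 beta_gt1.
by rewrite /endpoint_gap [odd k.+1]/=; case: (odd k) => /= ? ? ? ? ?; lra.
Qed.

(** Each level embeds in the next by division by [-beta], through the branch of digit 0. Only [l]
    would leave the interval, and it is never a zero. *)
Lemma zeros_nested m n v : (n <= m)%N -> zeros n v ->
  exists2 u, zeros m u & (- beta) ^+ n * v = (- beta) ^+ m * u.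
Proof.
have b1 := beta_gt1; elim: m => [|m IH].
  by rewrite leqn0 => /eqP -> zv; exists v.
rewrite leq_eqVlt => /orP[/eqP -> zv|nm zv]; first by exists v.
have [u zu ->] := IH nm zv.
have [w hw] := preimage_exists beta_gt1 (u + 0%:~R).
have [/(I_E beta_gt1)/andP[lu ur] _] := zu.
have lu' : l < u.
  rewrite lt_neqAle lu andbT; apply/eqP => e; rewrite -e in zu.
  exact: (zeros_neq_l beta_gt1 digit_gt0 zu).
have := l_lt0 beta_gt1; have := l_gtN1 beta_gt1; have := beta_l beta_gt1 => bl l1 l0.
exists w; last by rewrite exprSr -mulrA hw addr0.
apply: (zeros_branch beta_gt1 _ zu hw).
by rewrite addr0 in hw; apply/(I_E beta_gt1)/andP; split; nra.
Qed.

Lemma beta_integers_gap x y : consecutive (beta_integers beta) x y ->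
  exists k, y - x = if k is k'.+1 then D k' + D k else 1.
Proof.
have b1 := beta_gt1; move=> [/beta_integersP[n n0 [u zu ->]]].
move=> /beta_integersP[m m0 [v zv ->]] xy nb.
(* Both points are lifted to a common even level, where the scaling factor is positive and preserves
   order. *)
have [|u' zu' eu] := @zeros_nested (n + m).*2 n u _ zu.
  by rewrite -addnn -addnA leq_addr.
have [|v' zv' ev] := @zeros_nested (n + m).*2 m v _ zv.
  by rewrite -addnn addnC -addnA leq_addr.
have evenN : (- beta) ^+ (n + m).*2 = beta ^+ (n + m).*2.
  by rewrite exprNn -signr_odd odd_double expr0 mul1r.
have bN : 0 < beta ^+ (n + m).*2 by apply: exprn_gt0; lra.
rewrite eu ev evenN in xy nb *.
rewrite ltr_pM2l // in xy.
have cons : consecutive (zeros (n + m).*2) u' v'.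
  split=> // z zz.
  have := nb (beta ^+ (n + m).*2 * z); rewrite !ltr_pM2l //; apply.
  apply/beta_integersP; exists (n + m).*2; first by rewrite double_gt0 addn_gt0 n0.
  by exists z; rewrite ?evenN.
have [k hk] := zeros_gap beta_gt1 digit_gt0 digit_lt cons.
by exists k; rewrite -mulrBr.
Qed.

End Expansion.

Unset Implicit Arguments.
Set Strict Implicit.

Theorem theorem5p7 (R : realType) (beta : R) (d : nat -> int)
    (hbeta : (1 + Num.sqrt 5) / 2 <= beta)
    (hd : forall i, (1 <= i)%N -> d i = expansion beta (l_ beta) i)
    (hcond : forall i, (1 <= i)%N -> 0 < d i /\ d (2 * i)%N < d 1%N) :
  forall x y : R, consecutive (beta_integers beta) x y ->
    (exists k : nat, `|y - x| = Delta beta d k) /\ `|y - x| < 2.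
Proof.
have beta_gt1 : 1 < beta.
  have : Num.sqrt 1 < Num.sqrt 5 :> R by rewrite ltr_sqrt ?ltr1n.
  by rewrite sqrtr1 => ?; lra.
have digit_gt0 k : 0 < digit beta (iter k (T_ beta) (l_ beta)).
  by have [] := hcond k.+1 isT; rewrite hd.
have digit_lt k : odd k ->
    digit beta (iter k (T_ beta) (l_ beta)) < digit beta (l_ beta).
  (* [digit (t k)] is d_{k+1}, so an odd [k] corresponds to d_{2i} with [i = k.+1./2]. *)
  move=> ok; have i0 : (0 < k.+1./2)%N by case: k ok.
  have [_] := hcond _ i0.
  by rewrite mul2n halfK oddS ok subn0 !hd.
move=> x y xy; have [k hk] := beta_integers_gap beta_gt1 digit_gt0 digit_lt xy.
have [_ _ ltxy _] := xy.
rewrite gtr0_norm ?subr_gt0 // hk -(DeltaE beta_gt1 digit_gt0 k hd).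
by split; [exists k|exact: Delta_lt2].
Qed.
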